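(* Let $G(C\cup I,E)$ be a connected non-trivial $I_1$-split graph, and let $N(I)=\bigcup_{u\in I}N(u)$. Then the total domination number of $G$ satisfies $\gamma_t(G)=\max\{2,|N(I)|\}$. Hence an optimal (minimum) total dominating set of $G$ can be found in linear time.
   Context: All graphs are finite, simple and undirected; $N(u)$ is the set of neighbours of $u$. A vertex subset $D$ of $G$ is a total dominating set if every vertex of $G$ is adjacent to some vertex of $D$; $\gamma_t(G)$ is the minimum size of a total dominating set. A split graph $G(C\cup I,E)$ is a graph with a vertex partition $V(G)=C\cup I$ where $C$ is a clique and $I$ an independent set. An $I_1$-split graph is a split graph $G(C\cup I,E)$ with $\deg_G(v)=1$ for every $v\in I$. Non-trivial means having at least two vertices. *)

(* Defs.v *)
From mathcomp Require Import all_boot.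

Set Implicit Arguments.
Unset Strict Implicit.
Unset Printing Implicit Defensive.

Record sgraph (T : finType) := SGraph {
  edge :> rel T;
  edge_sym : symmetric edge;
  edge_irrefl : irreflexive edge
}.

Section Graphs.
Variables (T : finType) (G : sgraph T).
Implicit Types (C I D : {set T}).

Definition nbrs (u : T) : {set T} := [set v | G u v].

Definition deg (u : T) : nat := #|nbrs u|.

Definition nbrs_of I : {set T} := \bigcup_(u in I) nbrs u.

Definition connected : Prop := forall u v, connect G u v.

Definition clique C : Prop := {in C &, forall u v, u != v -> G u v}.

Definition independent I : Prop := {in I &, forall u v, ~~ G u v}.

(* Either part may be empty. *)
Definition split_partition C I : Prop :=
  [/\ C :|: I = [set: T], [disjoint C & I], clique C & independent I].

Definition I1_split_partition C I : Prop :=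
  split_partition C I /\ {in I, forall v, deg v = 1}.

Definition total_dominating D : bool :=
  [forall v, [exists u in D, G v u]].

(* If G has an isolated vertex, it has no total dominating set and the value  *)
(* is the irrelevant #|T|; otherwise [set: T] is a total dominating set.      *)
Definition gamma_t : nat :=
  #|[arg min_(D < [set: T] | total_dominating D) #|D|]|.

Definition minimum_total_dominating D : Prop :=
  total_dominating D /\
  forall D' : {set T}, total_dominating D' -> #|D| <= #|D'|.

End Graphs.

(* A word RAM with unit-cost instructions. A program is a list of             *)
(* instructions and can only name fixed registers; the memory is accessed     *)
(* indirectly, through addresses held in registers.                           *)
Inductive instr : Type :=
  | Const of nat & nat          (* r := k *)
  | Add of nat & nat & nat      (* r := a + b *)
  | Monus of nat & nat & nat    (* r := a - b, truncated at 0 *)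
  | Read of nat & nat           (* r := ram[a] *)
  | Write of nat & nat          (* ram[a] := b *)
  | Jpos of nat & nat.          (* jump to instruction l if r > 0 *)

Record state : Type := State {
  pc : nat;
  reg : nat -> nat;
  ram : nat -> nat
}.

Section RAM.
Variables (W : nat) (P : seq instr).

(* Words hold the numbers below W: the machine is stuck, without having       *)
(* halted, as soon as it computes a number that does not fit. Since           *)
(* registers then stay below W, so do all the addresses in use.               *)
Definition set_reg (s : state) (r k : nat) : option state :=
  if k < W then Some (State (pc s).+1 [eta reg s with r |-> k] (ram s))
  else None.

Definition exec (i : instr) (s : state) : option state :=
  match i with
  | Const r k => set_reg s r k
  | Add r a b => set_reg s r (reg s a + reg s b)
  | Monus r a b => set_reg s r (reg s a - reg s b)
  | Read r a => set_reg s r (ram s (reg s a))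
  | Write a b =>
      Some (State (pc s).+1 (reg s) [eta ram s with reg s a |-> reg s b])
  | Jpos r l =>
      Some (State (if 0 < reg s r then l else (pc s).+1) (reg s) (ram s))
  end.

Definition step (s : state) : option state :=
  if onth P (pc s) is Some i then exec i s else None.

Fixpoint run (t : nat) (s : state) : option state :=
  if t is t'.+1 then obind (run t') (step s) else Some s.

Definition halted (s : state) : Prop := size P <= pc s.

Definition init (x : seq nat) : state :=
  State 0 (fun=> 0) (fun i => nth 0 x i).

(* The output y is found in memory as its length followed by its items.       *)
Definition outputs_within (t : nat) (x y : seq nat) : Prop :=
  exists k s,
    [/\ k <= t, run k (init x) = Some s, halted s, ram s 0 = size y
      & forall i, i < size y -> ram s i.+1 = nth 0 y i].

End RAM.

(* The neighbours of each vertex are listed once, in an arbitrary order.      *)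
Definition adjacency_lists n (G : sgraph 'I_n) (adj : 'I_n -> seq 'I_n) : Prop :=
  forall u, uniq (adj u) /\ adj u =i nbrs G u.

(* Adjacency lists stored as contiguous arrays: the number n of vertices,     *)
(* then n + 1 offsets o_0, ..., o_n, then the concatenation of the lists, the *)
(* list of vertex i occupying positions o_i, ..., o_(i + 1) - 1 of the last   *)
(* part. The length of this word sequence is n + 2 + 2m, with m the number of *)
(* edges.                                                                     *)
Definition encode_adjacency n (adj : 'I_n -> seq 'I_n) : seq nat :=
  let L := [seq [seq val v | v <- adj u] | u <- enum 'I_n] in
  n :: [seq sumn (take i (shape L)) | i <- iota 0 n.+1] ++ flatten L.

(* One program, with time and word bounds linear in the length of the input   *)
(* (hence words of logarithmic bit length), finds, for every graph in Inst    *)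
(* and every presentation of it by adjacency lists, a vertex set satisfying   *)
(* Sol, listed without repetition. A solution need not be unique, and may     *)
(* depend on the presentation.                                                *)
Definition linear_time_solvable
    (Inst : forall n, sgraph 'I_n -> Prop)
    (Sol : forall n, sgraph 'I_n -> {set 'I_n} -> Prop) : Prop :=
  exists (P : seq instr) (c : nat),
  forall n (G : sgraph 'I_n) (adj : 'I_n -> seq 'I_n),
    Inst n G -> adjacency_lists G adj ->
    let x := encode_adjacency adj in
    exists s : seq 'I_n,
      [/\ uniq s, Sol n G [set v in s]
        & outputs_within (c * size x) P (c * size x) x [seq val v | v <- s]].

(* Main.v *)
Require Import Defs.
From mathcomp Require Import all_boot zify.

(* Every total dominating set contains N(I) and has at least two vertices. A  *)
(* superset S of N(I) that contains an edge ab is total dominating: one of a, *)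
(* b, say a, lies in C, so it dominates C minus a, while b dominates a, and   *)
(* N(I) dominates I. Hence N(I), padded to an edge if it has fewer than two   *)
(* vertices, is optimal.                                                      *)
(* The algorithm is not given C and I, and works with the supports instead,   *)
(* i.e. the neighbours of all vertices of degree 1, be they in I or in C. It  *)
(* scans the vertices once and marks the neighbour of each leaf. If it finds  *)
(* a single support, it adds a leaf; if it finds none, the graph is complete  *)
(* and any two vertices do.                                                   *)

Set Implicit Arguments.
Unset Strict Implicit.
Unset Printing Implicit Defensive.

(** For the formula, [nbrs_of_sub_total_dominating] and [total_dominating_gt1] give the lower bound,
    and [total_dominating_edge] shows that a set attaining it dominates
    ([exists_minimum_total_dominating]). For the algorithm, supports are forced into every total
    dominating set just as N(I) is, so the same edge criterion makes them optimal, up to padding.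
    The loop invariant [scanned], preserved by [scan_step], shows that the program lists the
    supports in linear time, and [padded_minimum] matches its three possible outputs with three
    minimum sets. *)

Section TotalDomination.
Variables (T : finType) (G : sgraph T).
Implicit Types (C I D S : {set T}).

Lemma adjacent_neq u v : G u v -> u != v.
Proof. by apply: contraTneq => ->; rewrite edge_irrefl. Qed.

Lemma connected_nbr : connected G -> 1 < #|T| -> forall v, exists u, G v u.
Proof.
move=> Gconn /card_gt1P[a [b [_ _ ab]]] v.
have [w vw]: exists w, v != w.
  by have [va|] := eqVneq v a; [exists b; rewrite va | exists a].
have /connectP[[|u p] /= pth lst] := Gconn v w; first by rewrite lst eqxx in vw.
by exists u; case/andP: pth.
Qed.

Lemma total_dominatingP D :
  reflect (forall v, exists2 u, u \in D & G v u) (total_dominating G D).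
Proof. by apply: (iffP 'forall_exists_inP). Qed.

Lemma total_dominating_gt1 D : 0 < #|T| -> total_dominating G D -> 1 < #|D|.
Proof.
move=> /card_gt0P[v _] /total_dominatingP domD.
have [u uD _] := domD v; have [w wD uw] := domD u.
by apply/card_gt1P; exists u, w; split=> //; apply: adjacent_neq.
Qed.

Lemma total_dominating_leaf D v w :
  total_dominating G D -> nbrs G v = [set w] -> w \in D.
Proof.
move=> /total_dominatingP/(_ v)[u uD vu] /setP/(_ u).
by rewrite !inE vu => /esym/eqP <-.
Qed.

(** Enlarging [D] to the whole vertex set keeps it dominating, so the default of the arg min in
    [gamma_t] is legitimate. *)
Lemma minimum_total_dominating_gamma_t D :
  minimum_total_dominating G D -> gamma_t G = #|D|.
Proof.
move=> [domD minD]; have domT : total_dominating G [set: T].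
  apply/total_dominatingP => v.
  by have [u _ vu] := total_dominatingP _ domD v; exists u; rewrite ?inE.
rewrite /gamma_t; case: arg_minnP => // A domA minA.
by apply/eqP; rewrite eqn_leq minA // minD.
Qed.

Definition supports : {set T} := [set w | [exists v, nbrs G v == [set w]]].

Lemma supports_mem v w : nbrs G v = [set w] -> w \in supports.
Proof. by move=> vw; rewrite inE; apply/existsP; exists v; rewrite vw. Qed.

(** * Minimum total dominating sets of I1-split graphs *)

Section SplitGraph.
Variables C I : {set T}.
Hypotheses (Gconn : connected G) (T_gt1 : 1 < #|T|).
Hypothesis GCI : I1_split_partition G C I.

Lemma split_cover v : v \notin I -> v \in C.
Proof.
by case: GCI => -[/setP/(_ v) + _ _ _] _; rewrite !inE => /orP[]// ->.
Qed.

Lemma split_clique u v : u \notin I -> v \notin I -> u != v -> G u v.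
Proof.
case: GCI => -[_ _ cliqueC _] _ uNI vNI.
by apply: cliqueC; apply: split_cover.
Qed.

Lemma pendant_nbr v : v \in I -> exists w, nbrs G v = [set w].
Proof. by case: GCI => _ /[apply]/eqP/cards1P. Qed.

Lemma pendant_indep u v : u \in I -> G u v -> v \notin I.
Proof.
by case: GCI => -[_ _ _ indI] _ uI; apply: contraTN => vI; apply: indI.
Qed.

Lemma nbrs_of_pendant u : u \in nbrs_of G I -> u \notin I.
Proof. by case/bigcupP=> v vI; rewrite inE; apply: pendant_indep. Qed.

Lemma total_dominating_edge S a b :
  nbrs_of G I \subset S -> a \in S -> b \in S -> G a b -> total_dominating G S.
Proof.
move=> NIS; wlog aNI : a b / a \notin I => [hw aS bS ab|aS bS ab].
  have [aI|aNI] := boolP (a \in I); last exact: (hw a b).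
  by apply: (hw b a); rewrite ?(pendant_indep aI) // edge_sym.
apply/total_dominatingP => v; have [vI|vNI] := boolP (v \in I).
  have [u vu] := connected_nbr Gconn T_gt1 v; exists u => //.
  by apply: (subsetP NIS); apply/bigcupP; exists v; rewrite ?inE.
have [->|va] := eqVneq v a; first by exists b.
by exists a => //; apply: split_clique.
Qed.

Lemma nbrs_of_sub_total_dominating D :
  total_dominating G D -> nbrs_of G I \subset D.
Proof.
move=> domD; apply/subsetP => u /bigcupP[v vI].
have [w vw] := pendant_nbr vI; rewrite vw => /set1P ->.
exact: total_dominating_leaf domD vw.
Qed.

Lemma minimum_total_dominating_pair a b :
  nbrs_of G I \subset [set a; b] -> G a b ->
  minimum_total_dominating G [set a; b].
Proof.
move=> NI ab; split.
  by apply: (total_dominating_edge NI _ _ ab); rewrite !inE eqxx ?orbT.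
move=> D domD; rewrite cards2 (adjacent_neq ab).
by apply: total_dominating_gt1 domD; apply: ltnW.
Qed.

Lemma exists_minimum_total_dominating :
  exists2 D, minimum_total_dominating G D & #|D| = maxn 2 #|nbrs_of G I|.
Proof.
have [NI_gt1|NI_le1] := ltnP 1 #|nbrs_of G I|.
  exists (nbrs_of G I); last by rewrite (maxn_idPr NI_gt1).
  have /card_gt1P[a [b [aN bN ab]]] := NI_gt1.
  split; last by move=> D /nbrs_of_sub_total_dominating/subset_leq_card.
  apply: (total_dominating_edge (subxx _) aN bN).
  by apply: split_clique; rewrite ?nbrs_of_pendant.
have [a NIa]: exists a, nbrs_of G I \subset [set a].
  have [->|/set0Pn[a aN]] := eqVneq (nbrs_of G I) set0.
    by have /card_gt0P[a _] := ltnW T_gt1; exists a; rewrite sub0set.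
  by exists a; apply/subsetP => b bN; rewrite inE; apply/eqP/(card_le1_eqP NI_le1).
have [b ab] := connected_nbr Gconn T_gt1 a.
exists [set a; b]; last by rewrite cards2 (adjacent_neq ab) (maxn_idPl (leqW NI_le1)).
by apply: minimum_total_dominating_pair ab; apply: subset_trans NIa (subsetUl _ _).
Qed.

Lemma gamma_t_I1_split : gamma_t G = maxn 2 #|nbrs_of G I|.
Proof.
have [D /minimum_total_dominating_gamma_t -> //] :=
  exists_minimum_total_dominating.
Qed.

Lemma nbrs_of_sub_supports : nbrs_of G I \subset supports.
Proof.
apply/subsetP => u /bigcupP[v vI].
have [w vw] := pendant_nbr vI; rewrite vw => /set1P ->.
exact: supports_mem vw.
Qed.

(** Optimality is immediate since each support is forced by its leaf; domination needs an edge
    inside [supports], which may contain vertices of [I]. *)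
Lemma minimum_total_dominating_supports :
  1 < #|supports| -> minimum_total_dominating G supports.
Proof.
move=> S_gt1; split; last first.
  move=> D domD; apply/subset_leq_card/subsetP => w; rewrite inE.
  by case/existsP=> v /eqP; apply: total_dominating_leaf domD.
have NIS := nbrs_of_sub_supports.
have [SNI|] := boolP [disjoint supports & I].
  have /card_gt1P[a [b [aS bS ab]]] := S_gt1.
  apply: (total_dominating_edge NIS aS bS).
  by apply: split_clique; rewrite // (disjointFr SNI).
(* A support vertex lying in I is itself a leaf, so its neighbour is a        *)
(* support vertex too.                                                        *)
rewrite -setI_eq0 => /set0Pn[s /setIP[sS sI]].
have [w sw] := pendant_nbr sI; have wS := supports_mem sw.
apply: (total_dominating_edge NIS sS wS).
by move/setP/(_ w): sw; rewrite !inE eqxx.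
Qed.

Lemma minimum_total_dominating_support1 u w :
  supports = [set w] -> G u w -> minimum_total_dominating G [set w; u].
Proof.
move=> sup1 uw; apply: minimum_total_dominating_pair; last by rewrite edge_sym.
by rewrite -sup1; apply: subset_trans nbrs_of_sub_supports (subsetUl _ _).
Qed.

Lemma minimum_total_dominating_no_support a b :
  supports = set0 -> a != b -> minimum_total_dominating G [set a; b].
Proof.
move=> sup0 ab.
(* A vertex of [I] would have a support as neighbour; so [I] is empty and the graph is complete. *)
have NI v : v \notin I.
  by apply/negP => /pendant_nbr[w] /supports_mem; rewrite sup0 inE.
apply: minimum_total_dominating_pair; last exact: split_clique.
by apply: subset_trans nbrs_of_sub_supports _; rewrite sup0 sub0set.
Qed.

End SplitGraph.
End TotalDomination.

(** * Symbolic execution of RAM programs *)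

Section SymbolicExecution.
Variables (W : nat) (P : seq instr).
Implicit Types (s : state) (l : seq nat) (m : nat -> nat).

(** A finite list stands for all registers, those beyond its end being 0; pointwise equality avoids
    function extensionality. *)
Definition configured s p l m :=
  [/\ pc s = p, reg s =1 nth 0 l & ram s =1 m].

(** Here [t] is only an upper bound, so branches of different lengths can share one bound. *)
Definition reaches t s (Q : state -> Prop) :=
  exists k s', [/\ k <= t, run W P k s = Some s' & Q s'].

Lemma reaches_now t s (Q : state -> Prop) : Q s -> reaches t s Q.
Proof. by exists 0, s. Qed.

Lemma run_add j k s : run W P (j + k) s = obind (run W P k) (run W P j s).
Proof. by elim: j s => //= j IHj s; case: step => //=. Qed.

Lemma reaches_trans t1 t2 s (Q1 Q2 : state -> Prop) :
  reaches t1 s Q1 -> (forall s', Q1 s' -> reaches t2 s' Q2) ->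
  reaches (t1 + t2) s Q2.
Proof.
move=> [j [s1 [jt1 run1 Qs1]]] /(_ s1 Qs1)[k [s2 [kt2 run2 Qs2]]].
by exists (j + k), s2; rewrite leq_add // run_add run1.
Qed.

Lemma reaches_leq t1 t2 s (Q : state -> Prop) :
  t1 <= t2 -> reaches t1 s Q -> reaches t2 s Q.
Proof.
by move=> t12 [k [s' [kt1 run1 Qs']]]; exists k, s'; rewrite (leq_trans kt1).
Qed.

Lemma reaches_step t s s' (Q : state -> Prop) :
  step W P s = Some s' -> reaches t s' Q -> reaches t.+1 s Q.
Proof. by move=> st [k [s2 [kt run2 Qs2]]]; exists k.+1, s2; rewrite /= st. Qed.

Definition assignment i l m : option (nat * nat) :=
  match i with
  | Const r k => Some (r, k)
  | Add r a b => Some (r, nth 0 l a + nth 0 l b)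
  | Monus r a b => Some (r, nth 0 l a - nth 0 l b)
  | Read r a => Some (r, m (nth 0 l a))
  | _ => None
  end.

Lemma reaches_assign t s p l m i r k (Q : state -> Prop) :
  configured s p l m -> onth P p = Some i ->
  assignment i l m = Some (r, k) -> k < W ->
  (forall s', configured s' p.+1 (set_nth 0 l r k) m -> reaches t s' Q) ->
  reaches t.+1 s Q.
Proof.
move=> [pcs regs rams] Pp asg kW reachQ.
pose s' := State p.+1 [eta reg s with r |-> k] (ram s).
apply: (@reaches_step _ _ s'); last first.
  by apply: reachQ; split=> // j; rewrite nth_set_nth /= regs.
rewrite /step {}/s' pcs Pp.
by case: i asg kW {Pp} => //= [? ?|? ? ?|? ? ?|? ?] [<- <-] kW;
  rewrite /set_reg ?rams ?regs ?rams kW pcs.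
Qed.

Lemma reaches_write t s p l m a b (Q : state -> Prop) :
  configured s p l m -> onth P p = Some (Write a b) ->
  (forall s', configured s' p.+1 l [eta m with nth 0 l a |-> nth 0 l b] ->
     reaches t s' Q) ->
  reaches t.+1 s Q.
Proof.
move=> [pcs regs rams] Pp reachQ.
apply: reaches_step; first by rewrite /step pcs Pp.
by apply: reachQ; split=> [||j] //=; rewrite ?pcs // !regs rams.
Qed.

Lemma reaches_jump t s p l m r q (Q : state -> Prop) :
  configured s p l m -> onth P p = Some (Jpos r q) ->
  (forall s', configured s' (if 0 < nth 0 l r then q else p.+1) l m ->
     reaches t s' Q) ->
  reaches t.+1 s Q.
Proof.
move=> [pcs regs rams] Pp reachQ.
apply: reaches_step; first by rewrite /step pcs Pp.
by apply: reachQ; split=> //=; rewrite pcs regs.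
Qed.

End SymbolicExecution.

(** * Reading the encoded adjacency lists *)

Section Encoding.
Variables (n : nat) (adj : 'I_n -> seq 'I_n).
Local Notation x := (encode_adjacency adj).

Definition offset i := sumn (take i [seq size (adj u) | u <- enum 'I_n]).

Lemma size_map_enum_ord A (f : 'I_n -> A) : size [seq f u | u <- enum 'I_n] = n.
Proof. by rewrite size_map size_enum_ord. Qed.

Lemma offsetS (v : 'I_n) : offset v.+1 = offset v + size (adj v).
Proof.
rewrite /offset (take_nth 0) ?size_map_enum_ord // sumn_rcons.
by rewrite (nth_map v) ?size_enum_ord // nth_ord_enum.
Qed.

Lemma offset_leq i : offset i <= offset n.
Proof.
rewrite /offset [in leqRHS]take_oversize ?size_map_enum_ord //.
by rewrite -[in leqRHS](cat_take_drop i (map _ _)) sumn_cat leq_addr.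
Qed.

Lemma shape_encode :
  shape [seq [seq val v | v <- adj u] | u <- enum 'I_n] =
  [seq size (adj u) | u <- enum 'I_n].
Proof. by rewrite /shape -map_comp; apply: eq_map => u /=; rewrite size_map. Qed.

Lemma encode_adjacencyE :
  x = n :: [seq offset i | i <- iota 0 n.+1] ++
           flatten [seq [seq val v | v <- adj u] | u <- enum 'I_n].
Proof. by rewrite /encode_adjacency shape_encode. Qed.

Lemma size_encode : size x = n.+2 + offset n.
Proof.
rewrite /= size_cat size_map size_iota size_flatten shape_encode /offset.
by rewrite take_oversize ?size_map_enum_ord // addSn.
Qed.

Lemma nth_encode_offset i : i <= n -> nth 0 x i.+1 = offset i.
Proof.
move=> le_in; rewrite encode_adjacencyE -[LHS]/(nth 0 (_ ++ _) i) nth_cat.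
by rewrite size_map size_iota ltnS le_in (nth_map 0) ?size_iota // nth_iota.
Qed.

Lemma nth_encode_adjacent (v : 'I_n) j :
  j < size (adj v) ->
  nth 0 x (n.+2 + offset v + j) = nth 0 [seq val w | w <- adj v] j.
Proof.
move=> j_lt; rewrite encode_adjacencyE -addnA addSn.
rewrite -[LHS]/(nth 0 (_ ++ _) _) nth_cat size_map size_iota.
rewrite ltnNge leq_addr addKn /=.
(* The lists before that of [v] flatten to exactly [offset v] words. *)
rewrite -[X in flatten X](cat_take_drop v) flatten_cat nth_cat.
rewrite size_flatten /shape map_take -/(shape _) shape_encode -/(offset v).
rewrite ltnNge leq_addr /= addKn.
rewrite (drop_nth [::]) ?size_map_enum_ord //= nth_cat.
by rewrite (nth_map v) ?size_enum_ord // nth_ord_enum size_map j_lt.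
Qed.

End Encoding.

(* Registers: 0 holds 1, 1 the number n of vertices, 2 the current vertex i,  *)
(* 3 the address n + 2 of the adjacency lists, 4 the address of the marks,    *)
(* just after the input, 5 the number of supports found, 6 the last leaf      *)
(* found, 11 always 0. The loop runs from 7 to 25, and 23 skips to the next   *)
(* vertex. The supports overwrite the input from address 1 on: at most i + 1  *)
(* of them are written by the end of round i, while later rounds only read    *)
(* addresses from i + 2 on.                                                   *)
Definition leaf_scan : seq instr := [::
  Const 0 1;
  Read 1 2;
  Add 10 1 0;
  Read 8 10;
  Add 3 10 0;
  Add 4 3 8;
  Const 6 1;
  Add 9 2 0;
  Read 7 9;
  Add 10 9 0;
  Read 8 10;
  Monus 8 8 7;
  Monus 8 8 0;
  Jpos 8 23;
  Add 7 3 7;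
  Read 7 7;
  Add 8 4 7;
  Add 6 2 11;
  Read 10 8;
  Jpos 10 23;
  Write 8 0;
  Add 5 5 0;
  Write 5 7;
  Add 2 2 0;
  Monus 7 1 2;
  Jpos 7 7;
  Jpos 5 29;
  Const 5 1;
  Write 5 11;
  Monus 7 5 0;
  Jpos 7 33;
  Add 5 0 0;
  Write 5 6;
  Write 11 5].

Ltac assign cfg :=
  eapply (reaches_assign cfg);
    [reflexivity | reflexivity | simpl | clear cfg => ? /= cfg].
Ltac write_ram cfg :=
  eapply (reaches_write cfg); [reflexivity | clear cfg => ? /= cfg].
Ltac jump cfg :=
  eapply (reaches_jump cfg); [reflexivity | clear cfg => ? /= cfg].

(** * Correctness and running time of [leaf_scan] *)

Section LeafScan.
Variables (n : nat) (adj : 'I_n -> seq 'I_n) (x : seq nat) (W : nat).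
Hypothesis def_x : x = encode_adjacency adj.
Hypotheses (n_gt1 : 1 < n) (adj_neq0 : forall v, 0 < size (adj v)).
(** The largest numbers computed are mark addresses, below [2 * size x]. *)
Hypothesis W_large : 4 * size x <= W.
Implicit Types (out : seq 'I_n) (m : nat -> nat) (s : state).

Lemma size_input : size x = n.+2 + offset adj n.
Proof. by rewrite def_x size_encode. Qed.

Lemma input_offset i : i <= n -> nth 0 x i.+1 = offset adj i.
Proof. by rewrite def_x; apply: nth_encode_offset. Qed.

Lemma input_leaf (v w : 'I_n) :
  adj v = [:: w] -> nth 0 x (n.+2 + offset adj v) = w.
Proof.
move=> vw; have := nth_encode_adjacent (adj := adj) (v := v) (j := 0).
by rewrite vw addn0 -def_x => ->.
Qed.

Definition supports_before i out :=
  uniq out /\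
  forall w, (w \in out) = [exists v : 'I_n, (v < i) && (adj v == [:: w])].

(* The initial value 1 of u lets the final instructions complete both a       *)
(* single support and the set {0}, chosen if there is none, by u.             *)
Definition leaf_witness out u :=
  if out is [::] then u = 1
  else exists v w, [/\ val v = u, adj v = [:: w] & w \in out].

(** The clauses describe the unread input, the marks after it, and the output. The last one confines
    the next output write to addresses up to [i.+1], where the input is no longer needed after round
    [i]. *)
Definition scan_memory i out m :=
  [/\ forall j, i < j < size x -> m j = nth 0 x j,
      forall w : 'I_n, m (size x + w) = (w \in out),
      forall j, j < size out -> m j.+1 = nth 0 [seq val v | v <- out] j
    & size out <= i].

Definition scanned i p s := exists out u a b c d m,
  [/\ configured s p [:: 1; n; i; n.+2; size x; size out; u; a; b; c; d] m,
      supports_before i out, leaf_witness out u & scan_memory i out m].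

Lemma supports_before0 : supports_before 0 [::].
Proof.
split=> // w; rewrite in_nil; apply/esym/existsP => -[v].
by rewrite ltn0.
Qed.

Lemma supports_beforeS_nonleaf (v : 'I_n) out :
  size (adj v) != 1 -> supports_before v out -> supports_before v.+1 out.
Proof.
move=> nleaf [uniq_out mem_out]; split=> // w; rewrite mem_out.
apply: eq_existsb => u; rewrite ltnS (leq_eqVlt u).
have [uv|//] := eqVneq (val u) v.
have ->: u = v by apply: val_inj.
by rewrite ltnn /=; apply/esym/negbTE; apply: contraNneq nleaf => ->.
Qed.

Lemma supports_beforeS_leaf (v w : 'I_n) out :
  adj v = [:: w] -> supports_before v out ->
  supports_before v.+1 (if w \in out then out else rcons out w).
Proof.
move=> vw [uniq_out mem_out]; split.
  by case: ifP => // w_out; rewrite rcons_uniq w_out.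
move=> w'.
have ->: [exists u : 'I_n, (u < v.+1) && (adj u == [:: w'])] =
         (w' == w) || (w' \in out).
  rewrite mem_out; apply/existsP/orP => [[u /andP[]]|].
    rewrite ltnS leq_eqVlt => /orP[/eqP/val_inj ->|uv adju].
      by rewrite vw => /eqP[->]; left.
    by right; apply/existsP; exists u; rewrite uv.
  case=> [/eqP->|/existsP[u /andP[uv adju]]].
    by exists v; rewrite ltnSn vw eqxx.
  by exists u; rewrite (ltn_trans uv).
case: ifP => [w_out|_]; last by rewrite mem_rcons inE.
by have [->|] := eqVneq w' w.
Qed.

Lemma scan_setup : reaches W leaf_scan 7 (init x) (scanned 0 7).
Proof.
have size_x := size_input.
(* An abstract [m] keeps simplification from unfolding the encoding. *)
have [m [mx cfg]] : exists m, m =1 nth 0 x /\ configured (init x) 0 [::] m.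
  by exists (nth 0 x); split=> //; split=> // j; rewrite nth_nil.
have m0 : m 0 = n by rewrite mx def_x.
have mn : m n.+1 = offset adj n by rewrite mx input_offset.
assign cfg; first by lia.
assign cfg; first by lia.
assign cfg; first by lia.
rewrite m0 addn1 in cfg.
assign cfg; first by lia.
rewrite mn in cfg.
assign cfg; first by lia.
assign cfg; first by lia.
assign cfg; first by lia.
rewrite !addn1 -size_x in cfg.
apply: reaches_now; exists [::], 1, 0, (offset adj n), 0, n.+1, m.
split=> //; first exact: supports_before0.
by split=> // w; rewrite mx nth_default // leq_addr.
Qed.

Lemma scan_memory_skip (v : 'I_n) out m :
  scan_memory v out m -> scan_memory v.+1 out m.
Proof.
case=> mx marks mout le_out; split=> //; last exact: leqW.
by move=> j /andP[vj jx]; rewrite mx // jx ltnW.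
Qed.

Lemma scan_memory_rcons (v w : 'I_n) out m :
  scan_memory v out m ->
  scan_memory v.+1 (rcons out w)
    [eta [eta m with size x + w |-> 1] with (size out).+1 |-> val w].
Proof.
have size_x := size_input; have v_lt := ltn_ord v.
case=> mx marks mout le_out; split=> [j /andP[vj jx]|w'|j|] /=.
- rewrite !ifN_eqC ?mx //; lia.
- rewrite ifN_eqC; last by lia.
  rewrite eqn_add2l mem_rcons inE marks -val_eqE.
  by case: eqVneq.
- rewrite size_rcons ltnS map_rcons nth_rcons size_map eqSS => le_j.
  have [->|j_neq] := eqVneq j (size out); first by rewrite ltnn.
  have j_lt : j < size out by rewrite ltn_neqAle j_neq.
  by rewrite j_lt ifN_eq ?mout //; lia.
- by rewrite size_rcons.
Qed.

Lemma scan_step (v : 'I_n) s :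
  scanned v 7 s ->
  reaches W leaf_scan 19 s (scanned v.+1 (if v.+1 < n then 7 else 26)).
Proof.
have size_x := size_input; have v_lt := ltn_ord v.
have le_o := offset_leq adj; have oS := offsetS adj v.
move=> [out [u [a [b [c [d [m [cfg sup wit mem]]]]]]]].
have [mx marks _ le_out] := mem.
have mo : m v.+1 = offset adj v by rewrite mx ?input_offset //; lia.
have moS : m v.+2 = offset adj v.+1 by rewrite mx ?input_offset //; lia.
(* The common tail of the round, instructions 23 to 25, is shared by its three branches: no leaf,
   known support, new support. *)
have next m' out' u' s' a' b' c' d' :
    configured s' 23 [:: 1; n; val v; n.+2; size x; size out'; u'; a'; b'; c'; d'] m' ->
    supports_before v.+1 out' -> leaf_witness out' u' ->
    scan_memory v.+1 out' m' ->
    reaches W leaf_scan 3 s' (scanned v.+1 (if v.+1 < n then 7 else 26)).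
  move=> {}cfg sup' wit' mem'.
  assign cfg; first by lia.
  assign cfg; first by lia.
  jump cfg.
  apply: reaches_now; rewrite addn1 subn_gt0 in cfg.
  by exists out', u', (n - v.+1), b', c', d', m'.
have le_oS := le_o v.+1.
assign cfg; first by lia.
rewrite addn1 in cfg.
assign cfg; first by rewrite mo; lia.
rewrite mo in cfg.
assign cfg; first by lia.
rewrite addn1 in cfg.
assign cfg; first by rewrite moS; lia.
rewrite moS in cfg.
assign cfg; first by lia.
assign cfg; first by lia.
jump cfg.
have := adj_neq0 v.
(* As degrees are positive, the tested value vanishes exactly at leaves. *)
have degE : offset adj v.+1 - offset adj v - 1 = (size (adj v)).-1.
  by rewrite oS; lia.
rewrite degE in cfg.
have [leaf _|nleaf adj_gt0] := eqVneq (size (adj v)) 1; last first.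
  rewrite ifT in cfg; last by lia.
  apply: (@reaches_leq _ _ 3) => //.
  apply: next cfg _ wit _; first exact: supports_beforeS_nonleaf.
  exact: scan_memory_skip.
have [w vw] : exists w, adj v = [:: w].
  by case: (adj v) leaf => [|w [|]] //; exists w.
have w_lt := ltn_ord w.
have mw : m (n.+2 + offset adj v) = w.
  by rewrite mx ?(input_leaf vw) //; lia.
rewrite vw /= in cfg.
assign cfg; first by lia.
assign cfg; first by rewrite mw; lia.
rewrite mw in cfg.
assign cfg; first by lia.
assign cfg; first by lia.
rewrite addn0 in cfg.
assign cfg; first by rewrite marks; case: (_ \in _); lia.
rewrite marks in cfg.
have sup' := supports_beforeS_leaf vw sup.
jump cfg.
case w_out: (w \in out) cfg sup' => /= cfg sup'.
  apply: (@reaches_leq _ _ 3) => //.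
  apply: next cfg sup' _ _; last exact: scan_memory_skip.
  by case: (out) w_out => // w1 out1 w_out; exists v, w.
write_ram cfg.
assign cfg; first by lia.
rewrite addn1 in cfg.
write_ram cfg.
have mem' := scan_memory_rcons w mem.
rewrite -(size_rcons out w) in cfg mem'.
apply: next cfg sup' _ mem'.
have: w \in rcons out w by rewrite mem_rcons mem_head.
by case: (rcons out w) => // w1 out1 w_in; exists v, w.
Qed.

Lemma scan_loop i s :
  i < n -> scanned i 7 s ->
  reaches W leaf_scan (19 * (n - i)) s (scanned n 26).
Proof.
have [k def_k] := ubnP (n - i); elim: k i s def_k => // k IHk i s le_k i_lt sc.
have -> : 19 * (n - i) = 19 + 19 * (n - i.+1) by lia.
apply: reaches_trans (scan_step (v := Ordinal i_lt) sc) _ => s' /=.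
case: ltnP => [iS_lt|n_le] sc'; first by apply: IHk => //; lia.
have iS : i.+1 = n by lia.
by apply: reaches_now; rewrite iS in sc'.
Qed.

Definition padded out u : seq nat :=
  match out with
  | [::] => [:: 0; 1]
  | [:: w] => [:: val w; u]
  | _ => [seq val w | w <- out]
  end.

Definition halts_with y s :=
  [/\ halted leaf_scan s, ram s 0 = size y
    & forall i, i < size y -> ram s i.+1 = nth 0 y i].

(** With no support, vertex 0 is written as a fake one and the code for a single support adds [u],
    which is still 1; this longest path takes 8 steps. *)
Lemma scan_finish s :
  scanned n 26 s ->
  reaches W leaf_scan 8 s (fun s' => exists out u,
    [/\ supports_before n out, leaf_witness out u
      & halts_with (padded out u) s']).
Proof.
have size_x := size_input.
move=> [out [u [a [b [c [d [m [cfg sup wit [_ _ mout le_out]]]]]]]]].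
have finish s' r m' : configured s' 34 r m' -> m' 0 = size (padded out u) ->
    (forall i, i < size (padded out u) -> m' i.+1 = nth 0 (padded out u) i) ->
    exists out u, [/\ supports_before n out, leaf_witness out u
                    & halts_with (padded out u) s'].
  move=> [pcs' _ rams'] m'0 m'S; exists out, u.
  by split=> //; split=> [||i /m'S <-]; rewrite /halted ?pcs' ?rams'.
jump cfg.
case: out {sup} wit mout le_out finish cfg => [|w out] /= wit mout le_out finish cfg.
  assign cfg; first by lia.
  write_ram cfg.
  assign cfg; first by lia.
  jump cfg.
  assign cfg; first by lia.
  write_ram cfg.
  write_ram cfg.
  apply: reaches_now; apply: finish cfg _ _ => //=.
  by case=> [|[|]].
assign cfg; first by lia.
rewrite subn1 /= in cfg.
jump cfg.
case: out wit mout le_out finish cfg => [|w' out] /= wit mout le_out finish cfg.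
  assign cfg; first by lia.
  write_ram cfg.
  write_ram cfg.
  apply: reaches_now; apply: finish cfg _ _ => //=.
  by case=> [|[|]] //= _; apply: (mout 0).
write_ram cfg.
apply: reaches_now; apply: finish cfg _ _ => /=; first by rewrite size_map.
by move=> i; rewrite size_map; apply: mout.
Qed.

Lemma leaf_scan_outputs :
  exists out u, [/\ supports_before n out, leaf_witness out u
    & outputs_within W leaf_scan (20 * size x) x (padded out u)].
Proof.
have size_x := size_input.
have : reaches W leaf_scan (7 + (19 * (n - 0) + 8)) (init x) (fun s' =>
    exists out u, [/\ supports_before n out, leaf_witness out u
      & halts_with (padded out u) s']).
  apply: reaches_trans scan_setup _ => s1 sc1.
  apply: reaches_trans (scan_loop (ltnW n_gt1) sc1) _ => s2.
  exact: scan_finish.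
case=> k [s' [le_k runk [out [u [sup wit [? ? ?]]]]]].
exists out, u; split=> //; exists k, s'; split=> //; lia.
Qed.

End LeafScan.

(** * From program output to minimum total dominating sets *)

Lemma padded_minimum n (G : sgraph 'I_n) (adj : 'I_n -> seq 'I_n) C I out u :
  connected G -> 1 < n -> I1_split_partition G C I -> adjacency_lists G adj ->
  supports_before adj n out -> leaf_witness adj out u ->
  exists s : seq 'I_n,
    [/\ uniq s, minimum_total_dominating G [set v in s]
      & [seq val v | v <- s] = padded out u].
Proof.
move=> Gconn n_gt1 GCI adjG [uniq_out mem_out] wit.
have T_gt1 : 1 < #|'I_n| by rewrite card_ord.
have nbrs1 v w : adj v = [:: w] -> nbrs G v = [set w].
  by have [_ mem_v] := adjG v => vw; apply/setP => z; rewrite -mem_v vw !inE.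
have sup : supports G = [set w in out].
  apply/setP => w; rewrite !inE mem_out.
  apply: eq_existsb => v; rewrite ltn_ord /=; apply/eqP/eqP; last exact: nbrs1.
  have [uniq_v mem_v] := adjG v => vw.
  apply: perm_small_eq => //; apply: uniq_perm => // z.
  by rewrite mem_v vw !inE.
case: out {mem_out} wit uniq_out sup => [|w [|w' out]] /= wit uniq_out sup.
- have a01 : Ordinal (ltnW n_gt1) != Ordinal n_gt1 by [].
  exists [:: Ordinal (ltnW n_gt1); Ordinal n_gt1]; split=> //.
  have -> : [set v in [:: Ordinal (ltnW n_gt1); Ordinal n_gt1]] =
            [set Ordinal (ltnW n_gt1); Ordinal n_gt1].
    by apply/setP => v; rewrite !inE.
  by apply: (minimum_total_dominating_no_support Gconn T_gt1 GCI).
(* The recorded leaf must hang on [w], the only support, so the two form an edge. *)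
- have [v [w1 [<- vw]]] := wit; rewrite inE => /eqP w1w; rewrite {}w1w in vw.
  have Gvw : G v w by have /setP/(_ w) := nbrs1 v w vw; rewrite !inE eqxx.
  exists [:: w; v]; split=> //=.
    by rewrite inE eq_sym (adjacent_neq Gvw).
  have -> : [set z in [:: w; v]] = [set w; v] by apply/setP => z; rewrite !inE.
  apply: (minimum_total_dominating_support1 Gconn T_gt1 GCI) => //.
  by rewrite sup; apply/setP => z; rewrite !inE.
- exists [:: w, w' & out]; split=> //.
  rewrite -sup; apply: (minimum_total_dominating_supports Gconn T_gt1 GCI).
  by rewrite sup cardsE (card_uniqP _).
Qed.

Theorem theorem13 :
  (forall (T : finType) (G : sgraph T) (C I : {set T}),
     connected G -> 1 < #|T| -> I1_split_partition G C I ->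
     gamma_t G = maxn 2 #|nbrs_of G I|)
  /\
  linear_time_solvable
    (fun (n : nat) (G : sgraph 'I_n) =>
       [/\ connected G, 1 < n
         & exists C I : {set 'I_n}, I1_split_partition G C I])
    (fun (n : nat) (G : sgraph 'I_n) (D : {set 'I_n}) =>
       minimum_total_dominating G D).
Proof.
split=> [T G C I|]; first exact: gamma_t_I1_split.
exists leaf_scan, 20 => n G adj [Gconn n_gt1 [C [I GCI]]] adjG x.
have adj_neq0 v : 0 < size (adj v).
  have T_gt1 : 1 < #|'I_n| by rewrite card_ord.
  have [w vw] := connected_nbr Gconn T_gt1 v.
  have [_ mem_v] := adjG v.
  by have: w \in adj v; [rewrite mem_v inE | case: (adj v)].
have W_large : 4 * size x <= 20 * size x by rewrite leq_mul2r orbT.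
have [out [u [sup wit outs]]] :=
  leaf_scan_outputs (erefl x) n_gt1 adj_neq0 W_large.
have [s [uniq_s min_s def_s]] := padded_minimum Gconn n_gt1 GCI adjG sup wit.
by exists s; rewrite def_s.
Qed.
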